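(* Let $F$ be the convolution operator on $L^{\infty}(\mathbb{R})$ induced by an element $f$ of $\mathscr{L}^1_{\flat}(\mathbb{R})$. Then every $\varphi \in M_F$ admits a Jordan decomposition in $M_F$, i.e. there exist positive elements $\varphi_+$ and $\varphi_-$ of $M_F$ such that \[\varphi = \varphi_+ - \varphi_-, \quad \|\varphi\| = \|\varphi_+\| + \|\varphi_-\|.\]
   Context: All functions are real-valued. $L^{\infty}(\mathbb{R})$ is the space of essentially bounded functions on $\mathbb{R}$ and $L^{\infty}(\mathbb{R})^*$ its dual. For $f \in L^1(\mathbb{R})$, $\hat{f}(\xi) = \int_{-\infty}^{\infty} f(x)e^{-i\xi x}dx$. $\mathscr{L}^1_{\flat}(\mathbb{R})$ is the set of $f \in L^1(\mathbb{R})$ with $f \ge 0$ and $\hat{f}(0) = 1$. The convolution operator induced by $f$ is $F : L^{\infty}(\mathbb{R}) \to L^{\infty}(\mathbb{R})$, $(F\phi)(x) = (f*\phi)(x) = \int_{-\infty}^{\infty}\phi(x-t)f(t)dt$. $M_F$ is the set of all $\varphi \in L^{\infty}(\mathbb{R})^*$ that are $F$-invariant, i.e. $\varphi(F\phi) = \varphi(\phi)$ for all $\phi \in L^{\infty}(\mathbb{R})$. A functional $\varphi$ is positive if $\varphi(\phi) \ge 0$ whenever $\phi \ge 0$. *)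

(* Defs.v *)
From HB Require Import structures.
From mathcomp Require Import all_boot all_order all_algebra.
From mathcomp Require Import complex.
From mathcomp Require Import all_classical all_reals all_analysis.
From mathcomp Require Import ess_sup_inf measurable_realfun.
From mathcomp Require Import ring lra.

Set Implicit Arguments.
Unset Strict Implicit.
Unset Printing Implicit Defensive.
Import Order.TTheory GRing.Theory Num.Theory.
Import numFieldNormedType.Exports.

Local Open Scope classical_set_scope.
Local Open Scope ring_scope.

(* The library provides L^p as the type [LspaceType] of classes of measurable
   functions modulo a.e. equality, but without algebraic or normed structure;
   we equip it with the operations and the norm inherited from functions. *)
Section Lspace_normedModType.
Context d (T : measurableType d) (R : realType).
Variables (mu : {measure set T -> \bar R}) (p : \bar R) (p1 : (1 <= p)%E).
Local Notation Lp := (LspaceType mu p1).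

Lemma ae_eq_Lnorm (f g : T -> R) :
  measurable_fun setT f -> measurable_fun setT g -> f = g %[ae mu] ->
  ('N[mu]_p[EFin \o f] = 'N[mu]_p[EFin \o g])%E.
Proof.
move=> mf mg fg; rewrite unlock /Lnorm; case: p p1 => [r| |//] _.
- have mN (h : T -> R) : measurable_fun setT h ->
      measurable_fun setT ((fun x => `|(EFin \o h) x| `^ r)%E : T -> \bar R).
    move=> mh; apply: (measurableT_comp (measurable_poweR _)).
    by apply: measurableT_comp => //; exact/measurable_EFinP.
  congr (_ `^ _)%E; apply: ae_eq_integral => //; [exact: mN|exact: mN|].
  by apply: filterS fg => x /= h _; rewrite (h I).
- case: ifPn => // _; apply: eq_ess_sup.
  by apply: filterS fg => x /= /(_ I) ->.
Qed.

Lemma Lspace_repr_subproof (f : Lp) : (f : T -> R) \in Lfun mu p.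
Proof.
apply/andP; split; last by rewrite inE/=; exact: Lebesgue_finite.
rewrite inE/=.
exact: (measurable_funPT (repr (f : {mfun_ mu, T >-> measurableTypeR R}))%qT).
Qed.

Definition Lspace_repr (f : Lp) : LfunType mu p1 :=
  Lfun_Sub p1 (Lspace_repr_subproof f).

(* [LspaceType] is built on [measurableTypeR R], [LfunType] on [R]: the two
   carry the same sigma-algebra under different displays. *)
Lemma measurable_Lfun (f : LfunType mu p1) :
  measurable_fun setT (f : T -> measurableTypeR R).
Proof. exact: (measurable_funPT (f : {mfun T >-> R})). Qed.

Definition mfun_of_Lfun (f : LfunType mu p1) : {mfun T >-> measurableTypeR R} :=
  HB.pack_for {mfun T >-> measurableTypeR R} (f : T -> measurableTypeR R)
    (isMeasurableFun.Build _ _ T (measurableTypeR R) _ (measurable_Lfun f)).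

Definition Lspace_pi_mfun (f : LfunType mu p1) :
  {mfun_ mu, T >-> measurableTypeR R} :=
  (\pi_({mfun_ mu, T >-> measurableTypeR R}) (mfun_of_Lfun f))%qT.

Lemma Lspace_pi_mfunE (f : LfunType mu p1) :
  (Lspace_pi_mfun f : T -> R) = f %[ae mu].
Proof.
rewrite /Lspace_pi_mfun /aqEqMfun_to_fun.
case: piP => g /eqmodP/asboolP; exact: ae_eq_sym.
Qed.

Lemma Lspace_pi_subproof (f : LfunType mu p1) :
  finite_norm mu p (Lspace_pi_mfun f).
Proof.
have mpi : measurable_fun setT (Lspace_pi_mfun f : T -> R).
  exact: (measurable_funPT (repr (Lspace_pi_mfun f))%qT).
rewrite /finite_norm (ae_eq_Lnorm mpi _ (Lspace_pi_mfunE f)).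
  exact: Lfunction_finite.
exact: measurable_Lfun.
Qed.

Definition Lspace_pi (f : LfunType mu p1) : Lp :=
  HB.pack_for Lp (Lspace_pi_mfun f)
    (isFinLebesgue.Build d T R mu p p1 (Lspace_pi_mfun f) (Lspace_pi_subproof f)).

Lemma Lspace_piE (f : LfunType mu p1) : (Lspace_pi f : T -> R) = f %[ae mu].
Proof. exact: Lspace_pi_mfunE. Qed.

Lemma LspaceP (f g : Lp) : (f : T -> R) = g %[ae mu] -> f = g.
Proof.
case: f g => [f [[ff]]] [g [[gf]]] /= fg.
have e : f = g.
  by rewrite -[f]reprK -[g]reprK; apply/eqmodP/asboolP.
by move: ff gf {fg}; rewrite e => ff gf; congr LebesgueSpace.Pack;
  congr LebesgueSpace.Class; congr isFinLebesgue.Axioms_; exact: Prop_irrelevance.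
Qed.

Lemma Lspace_pi_eq (f g : LfunType mu p1) :
  f = g %[ae mu] -> Lspace_pi f = Lspace_pi g.
Proof.
move=> fg; apply: LspaceP.
apply: filterS3 fg (Lspace_piE f) (Lspace_piE g) => x /= fg hf hg _.
by apply: (etrans (hf I)); apply: (etrans (fg I)); exact/esym/hg.
Qed.

Lemma Lspace_piK (f : Lp) : Lspace_pi (Lspace_repr f) = f.
Proof. exact/LspaceP/Lspace_piE. Qed.

HB.instance Definition _ := gen_eqMixin Lp.
HB.instance Definition _ := gen_choiceMixin Lp.

Let zero : Lp := Lspace_pi 0.
Let opp (f : Lp) : Lp := Lspace_pi (- Lspace_repr f).
Let add (f g : Lp) : Lp := Lspace_pi (Lspace_repr f + Lspace_repr g).
Let scale (a : R) (f : Lp) : Lp := Lspace_pi (a *: Lspace_repr f).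

Let oppE f : opp (Lspace_pi f) = Lspace_pi (- f).
Proof.
apply: Lspace_pi_eq; apply: filterS (Lspace_piE f) => x /= h /h.
by move=> e; congr (- _).
Qed.

Let addE f g : add (Lspace_pi f) (Lspace_pi g) = Lspace_pi (f + g).
Proof.
apply: Lspace_pi_eq; apply: filterS2 (Lspace_piE f) (Lspace_piE g).
by move=> x /= hf hg _; congr (_ + _); [exact: hf|exact: hg].
Qed.

Let scaleE a f : scale a (Lspace_pi f) = Lspace_pi (a *: f).
Proof.
apply: Lspace_pi_eq; apply: filterS (Lspace_piE f) => x /= h /h.
by move=> e; congr (_ * _).
Qed.

Let addA : associative add.
Proof.
move=> f g h; rewrite -(Lspace_piK f) -(Lspace_piK g) -(Lspace_piK h).
by rewrite !addE addrA.
Qed.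

Let addC : commutative add.
Proof. by move=> f g; rewrite /add addrC. Qed.

Let add0 : left_id zero add.
Proof. by move=> f; rewrite -(Lspace_piK f) addE add0r. Qed.

Let addN : left_inverse zero opp add.
Proof. by move=> f; rewrite -(Lspace_piK f) oppE addE addNr. Qed.

HB.instance Definition _ := GRing.isZmodule.Build Lp addA addC add0 addN.

Let scaleA a b (f : Lp) : scale a (scale b f) = scale (a * b) f.
Proof. by rewrite -(Lspace_piK f) !scaleE scalerA. Qed.

Let scale1 : left_id 1 scale.
Proof. by move=> f; rewrite -(Lspace_piK f) scaleE scale1r. Qed.

Let scaleDr : right_distributive scale +%R.
Proof.
move=> a f g; rewrite -(Lspace_piK f) -(Lspace_piK g).
by rewrite /GRing.add/= !(addE, scaleE) scalerDr.
Qed.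

Let scaleDl (f : Lp) : {morph scale^~ f : a b / a + b}.
Proof.
move=> a b; rewrite -(Lspace_piK f).
by rewrite [in RHS]/GRing.add/= !(addE, scaleE) scalerDl.
Qed.

HB.instance Definition _ :=
  GRing.Zmodule_isLmodule.Build R Lp scaleA scale1 scaleDr scaleDl.

Definition Lspace_norm (f : Lp) : R := fine ('N[mu]_p[EFin \o (f : T -> R)])%E.

Lemma Lspace_norm_pi (f : LfunType mu p1) :
  Lspace_norm (Lspace_pi f) = fine ('N[mu]_p[EFin \o f])%E.
Proof.
have mpi : measurable_fun setT (Lspace_pi f : T -> R).
  exact: (measurable_Lfun (Lspace_repr (Lspace_pi f))).
rewrite /Lspace_norm (ae_eq_Lnorm mpi _ (Lspace_piE f)) //.
Qed.

Let Lspace_normD (f g : Lp) :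
  Lspace_norm (f + g) <= Lspace_norm f + Lspace_norm g.
Proof.
rewrite /GRing.add/= /add Lspace_norm_pi.
exact: (ler_LnormD (Lspace_repr f) (Lspace_repr g)).
Qed.

Let Lspace_normZ (a : R) (f : Lp) :
  Lspace_norm (a *: f) = `|a| * Lspace_norm f.
Proof.
rewrite /GRing.scale/= /scale Lspace_norm_pi.
apply: EFin_inj; rewrite EFinM finite_norm_fine.
rewrite [RHS](_ : _ = `|a|%:E * 'N[mu]_p[EFin \o Lspace_repr f])%E.
  exact: LnormZ.
by rewrite -finite_norm_fine.
Qed.

Let Lspace_norm_eq0 (f : Lp) : Lspace_norm f = 0 -> f = 0.
Proof.
move=> f0; have := @fine_Lnormr_eq0 _ _ _ _ _ p1 (Lspace_repr f) f0 => h.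
rewrite -(Lspace_piK f); exact: Lspace_pi_eq.
Qed.

HB.instance Definition _ := Lmodule_isNormed.Build R Lp
  Lspace_normD Lspace_normZ Lspace_norm_eq0.

Lemma Lspace_normE (f : Lp) :
  `|f| = fine ('N[mu]_p[EFin \o (f : T -> R)])%E.
Proof. by []. Qed.

Lemma Lspace_addE (f g : Lp) :
  ((f + g : Lp) : T -> R) = (fun x => (f : T -> R) x + (g : T -> R) x) %[ae mu].
Proof. exact: (Lspace_piE (Lspace_repr f + Lspace_repr g)). Qed.

Lemma Lspace_scaleE (a : R) (f : Lp) :
  ((a *: f : Lp) : T -> R) = (fun x => a * (f : T -> R) x) %[ae mu].
Proof. exact: (Lspace_piE (a *: Lspace_repr f)). Qed.

End Lspace_normedModType.

Notation L1 R := (LspaceType (@lebesgue_measure R) (lexx 1%E)).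
Notation Linfty R := (LspaceType (@lebesgue_measure R) (leey 1%E)).

Section convolution.
Variable R : realType.
Local Notation mu := (@lebesgue_measure R).
Implicit Types f phi : R -> R.

Definition conv f phi (x : R) : R := \int[mu]_t (phi (x - t) * f t).

Lemma measurable_conv f phi :
  measurable_fun setT f -> measurable_fun setT phi ->
  measurable_fun setT (conv f phi).
Proof.
move=> mf mphi; pose h (z : measurableTypeR R * measurableTypeR R) : \bar R :=
  (phi (z.1 - z.2) * f z.2)%:E.
have mh : measurable_fun setT h.
  apply/measurable_EFinP; apply: measurable_funM.
    apply: (measurableT_comp mphi); apply: measurable_funB.
      exact: measurable_fst.
    exact: measurable_snd.
  exact: (measurableT_comp mf).
have mF (g : R * R -> \bar R) : measurable_fun setT g -> (forall z, 0 <= g z)%E ->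
    measurable_fun setT (fun x : R => \int[mu]_t g (x, t))%E.
  exact: (@measurable_fun_fubini_tonelli_F _ _ (measurableTypeR R)
    (measurableTypeR R) R mu g).
rewrite /conv /Rintegral.
under eq_fun do rewrite integralE.
apply: measurableT_comp => //; apply: emeasurable_funB.
- rewrite [X in measurable_fun _ X](_ : _ =
    (fun x => \int[mu]_t (h^\+)%E (x, t))%E).
    exact: (mF (h^\+)%E (measurable_funepos mh) (fun z => funepos_ge0 h z)).
  by apply/funext => x; apply: eq_integral => t _; rewrite ?funeposE ?funenegE.
- rewrite [X in measurable_fun _ X](_ : _ =
    (fun x => \int[mu]_t (h^\-)%E (x, t))%E).
    exact: (mF (h^\-)%E (measurable_funeneg mh) (fun z => funeneg_ge0 h z)).
  by apply/funext => x; apply: eq_integral => t _; rewrite ?funeposE ?funenegE.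
Qed.

Lemma lebesgue_measure_reflect x (A : set R) : measurable A ->
  pushforward mu ((fun t => x - t) : R -> measurableTypeR R) A = mu A.
Proof.
move=> mA; apply/esym/lebesgue_measure_unique => //=.
  exact: measurable_funB.
move=> mr _ [[a b]] _ <-; rewrite /pushforward/=.
have -> : (fun t => x - t) @^-1` `]a, b]%classic = `[x - b, x - a[%classic.
  by apply/seteqP; split => t /=; rewrite !in_itv/=; move=> /andP[? ?];
    apply/andP; split; lra.
rewrite !lebesgue_measure_itv/= !lte_fin.
rewrite ltrD2l ltrN2; case: ifPn => // _.
by rewrite -!EFinB; congr EFin; lra.
Qed.

Lemma ae_reflect x (P : R -> Prop) :
  (\forall t \ae mu, P t) -> \forall t \ae mu, P (x - t).
Proof.
move=> [N [mN N0 PN]]; exists ((fun t => x - t) @^-1` N); split.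
- by rewrite -[X in measurable X]setTI; exact: measurable_funB.
- by rewrite -N0; exact: (lebesgue_measure_reflect x mN).
- by move=> t /= nP; apply: PN.
Qed.

Lemma measurable_conv_integrand f phi x :
  measurable_fun setT f -> measurable_fun setT phi ->
  measurable_fun setT ((fun t => phi (x - t) * f t) : measurableTypeR R -> R).
Proof.
move=> mf mphi; apply: measurable_funM; last exact: mf.
by apply: (measurableT_comp mphi); exact: measurable_funB.
Qed.

Lemma conv_ae_eq f g phi psi :
  measurable_fun setT f -> measurable_fun setT g ->
  measurable_fun setT phi -> measurable_fun setT psi ->
  f = g %[ae mu] -> phi = psi %[ae mu] -> conv f phi = conv g psi.
Proof.
move=> mf mg mphi mpsi fg phipsi; apply/funext => x.
rewrite /conv /Rintegral; congr fine; apply: ae_eq_integral => //.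
- by apply/measurable_EFinP; exact: measurable_conv_integrand.
- by apply/measurable_EFinP; exact: measurable_conv_integrand.
- have pt := ae_reflect x phipsi.
  move: fg pt; apply: (@filterS2 _ _ (ae_filter_ringOfSetsType mu)).
  move=> t /= ft pt _.
  by rewrite (ft I) (pt I).
Qed.

Lemma conv_bounded f phi : f \in Lfun mu 1 -> phi \in Lfun mu +oo ->
  exists C, forall x, `|conv f phi x| <= C.
Proof.
move=> /[dup] /sub_Lfun_mfun; rewrite inE/= => mf /Lfun1_integrable fi.
move=> /andP[]; rewrite !inE/= => mphi phifin.
have [M phiM] : exists M : R, \forall t \ae mu, `|phi t| <= M.
  move: phifin; rewrite /finite_norm unlock /Lnorm.
  case: ifPn => [_ /ess_supr_bounded//|]; last first.
  have muT : mu [set: measurableTypeR R] = +oo%E.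
    by have := @lebesgue_measure_itv R `]-oo, +oo[; rewrite set_itvNyy.
  rewrite [X in (0 < X)%E](_ : _ = +oo%E) ?ltry//; exact: muT.
have M0 : 0 <= `|M| by [].
pose C := (`|M|%:E * \int[mu]_t `|(f t)%:E|)%E.
have Cfin : C \is a fin_num.
  apply: fin_numM => //; have /integrableP[_ f_fin] := fi.
  by rewrite ge0_fin_numE// integral_ge0.
exists (fine C) => x.
have mh := measurable_conv_integrand x mf mphi.
have hC : (\int[mu]_t `|(phi (x - t) * f t)%:E| <= C)%E.
  rewrite /C -ge0_integralZl//; last first.
    by apply: measurableT_comp => //; exact/measurable_EFinP.
  apply: ae_ge0_le_integral => //.
  - by apply: measurableT_comp => //; exact/measurable_EFinP.
  - apply: measurable_funeM; apply: measurableT_comp => //.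
    exact/measurable_EFinP.
  - move: (ae_reflect x phiM).
    apply: (@filterS _ _ (ae_filter_ringOfSetsType mu)) => t /= pt _.
    rewrite -EFinM lee_fin normrM ler_wpM2r//.
    exact: (le_trans pt (ler_norm _)).
have hi : mu.-integrable setT (fun t => (phi (x - t) * f t)%:E).
  apply/integrableP; split; first exact/measurable_EFinP.
  by apply: (le_lt_trans hC); rewrite ltey_eq Cfin.
rewrite -lee_fin fineK// /conv EFin_normr_Rintegral//.
by apply: (le_trans (le_abse_integral _ _ _)) => //; exact/measurable_EFinP.
Qed.

Lemma conv_Lfun f phi : f \in Lfun mu 1 -> phi \in Lfun mu +oo ->
  conv f phi \in Lfun mu +oo.
Proof.
move=> fL phiL; have [C hC] := conv_bounded fL phiL.
move: fL phiL => /sub_Lfun_mfun + /sub_Lfun_mfun; rewrite !inE/= => mf mphi.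
apply/andP; split; rewrite inE/=; first exact: measurable_conv.
rewrite /finite_norm unlock /Lnorm; case: ifPn => // _.
apply: (@le_lt_trans _ _ C%:E); last exact: ltry.
by apply/ess_supP; apply: nearW => x /=; rewrite lee_fin.
Qed.

Lemma Lspace_Lfun p (p1 : (1 <= p)%E) (f : LspaceType mu p1) :
  (f : R -> R) \in Lfun mu p.
Proof. exact: Lspace_repr_subproof. Qed.

(* [conv f phi] is defined through representatives; by [conv_ae_eq] it only
   depends on the classes of f and phi. *)
Definition conv_op (f : L1 R) (phi : Linfty R) : Linfty R :=
  Lspace_pi (Lfun_Sub (leey 1%E) (conv_Lfun (Lspace_Lfun f) (Lspace_Lfun phi))).

Lemma conv_opE (f : L1 R) (phi : Linfty R) :
  (conv_op f phi : R -> R) = conv f phi %[ae mu].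
Proof. exact: Lspace_piE. Qed.

End convolution.

Section fourier.
Variable R : realType.
Local Notation mu := (@lebesgue_measure R).
Local Open Scope complex_scope.

Definition complex_integral (g : R -> R[i]) : R[i] :=
  (\int[mu]_x complex.Re (g x)) +i* (\int[mu]_x complex.Im (g x)).

(* e^(i y) *)
Definition expi (y : R) : R[i] := cos y +i* sin y.

Definition fourier (f : R -> R) (xi : R) : R[i] :=
  complex_integral (fun x => (f x)%:C * expi (- (xi * x))).

End fourier.

Section nonnegative.
Variables (R : realType) (p : \bar R) (p1 : (1 <= p)%E).

Definition Lspace_nonneg (u : LspaceType (@lebesgue_measure R) p1) : Prop :=
  \forall x \ae (@lebesgue_measure R), 0 <= (u : R -> R) x.

End nonnegative.

Definition L1flat (R : realType) : set (L1 R) :=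
  [set f | Lspace_nonneg f /\ fourier f 0 = 1].

Section dual.
Variables (R : realType) (V : normedModType R).

Definition dual : set {linear V -> R^o} := [set phi | continuous phi].

Definition dual_norm (phi : {linear V -> R^o}) : R :=
  sup [set `|phi v| | v in [set v : V | `|v| <= 1]].

End dual.

Section functionals_on_Linfty.
Variable R : realType.

Definition invariant_dual (F : Linfty R -> Linfty R) :
    set {linear Linfty R -> R^o} :=
  [set phi | dual phi /\ forall u, phi (F u) = phi u].

Definition positive_functional (phi : {linear Linfty R -> R^o}) : Prop :=
  forall u : Linfty R, Lspace_nonneg u -> 0 <= phi u.

End functionals_on_Linfty.

(* Main.v *)
(** [L^infty], ordered by the a.e. nonnegative functions, is a lattice with
    order unit 1, and its norm is the order-unit norm.  The positive part of
    [phi] is [phi+ u = sup (phi w | 0 <= w <= u)] for [u >= 0], extended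
    linearly.  For [0 <= w <= u] we have [0 <= F w <= F u] and
    [phi w = phi (F w)], so that [phi+ (F u) >= phi+ u]; since [F 1 = 1], the
    positive functional [phi+ \o F - phi+] vanishes at the order unit, hence
    everywhere.  The norm of a positive functional is its value at 1, and
    [w |-> 2 w - 1] maps the order interval [0, 1] onto the unit ball, which
    gives [phi+ 1 + phi- 1 = 2 phi+ 1 - phi 1 = |phi|]. *)

Require Import Defs.
From HB Require Import structures.
From mathcomp Require Import all_boot all_order all_algebra.
From mathcomp Require Import complex.
From mathcomp Require Import all_classical all_reals all_analysis.
From mathcomp Require Import ess_sup_inf measurable_realfun lra.
Import Order.TTheory GRing.Theory Num.Theory.
Import numFieldNormedType.Exports.
Local Open Scope classical_set_scope.
Local Open Scope ring_scope.

(** * Order-unit spaces with the Riesz decomposition property *)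

(** These axioms isolate what the argument uses of [L^infty]: [cone_normP] identifies the ball of
    radius [c] with the order interval from [- c e] to [c e], and [cone_riesz], the trace of the
    lattice structure, makes the positive part additive. *)
Record order_unit_cone (R : realType) (V : normedModType R) (P : set V) (e : V)
    : Prop := OrderUnitCone {
  coneD : forall u v, P u -> P v -> P (u + v) ;
  coneZ : forall a u, 0 <= a -> P u -> P (a *: u) ;
  cone_normP : forall u c, 0 <= c ->
    `|u| <= c <-> P (c *: e - u) /\ P (c *: e + u) ;
  cone_riesz : forall w u v, P w -> P u -> P v -> P (u + v - w) ->
    exists w1 w2, [/\ w = w1 + w2, P w1, P (u - w1), P w2 & P (v - w2)] }.

Arguments coneD {R V P e}.
Arguments coneZ {R V P e}.
Arguments cone_normP {R V P e}.
Arguments cone_riesz {R V P e}.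

Section order_unit_space.
Variables (R : realType) (V : normedModType R) (P : set V) (e : V).
Hypothesis Pe : order_unit_cone R V P e.

Lemma cone0 : P 0.
Proof.
have /(cone_normP Pe 0 0 (lexx _))[+ _] : `|0 : V| <= 0 by rewrite normr0.
by rewrite scale0r subr0.
Qed.

Lemma cone_unit : P e.
Proof.
have /(cone_normP Pe 0 1 ler01)[+ _] : `|0 : V| <= 1 by rewrite normr0.
by rewrite scale1r subr0.
Qed.

Lemma cone_norm u : P (`|u| *: e - u) /\ P (`|u| *: e + u).
Proof. exact/(cone_normP Pe). Qed.

Lemma cone_le_norm w u : P w -> P (u - w) -> `|w| <= `|u|.
Proof.
move=> Pw Puw; apply/(cone_normP Pe) => //; split.
  rewrite -[_ - w](subrKA u); apply: (coneD Pe) => //.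
  by case: (cone_norm u).
apply: (coneD Pe) => //; apply: (coneZ Pe) => //; exact: cone_unit.
Qed.

(* Every [u] is the difference [(u + |u| e) - |u| e] of two elements of the
   cone. *)
Lemma cone_linear_extension (p : V -> R) :
  (forall u v, P u -> P v -> p (u + v) = p u + p v) ->
  (forall a u, 0 <= a -> P u -> p (a *: u) = a * p u) ->
  exists q : {linear V -> R^o}, forall u, P u -> q u = p u.
Proof.
move=> pD pZ.
pose q u : R^o := p (`|u| *: e + u) - p (`|u| *: e).
have PZe a : 0 <= a -> P (a *: e).
  by move=> a0; apply: (coneZ Pe) => //; exact: cone_unit.
(* Additivity of [p] on the cone makes the value independent of the chosen decomposition; linearity
   then follows by picking convenient ones. *)
have qE u v w : P v -> P w -> u = v - w -> q u = p v - p w.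
  move=> Pv Pw uE; apply/eqP; rewrite /q subr_eq addrAC eq_sym subr_eq.
  have [_ Pu] := cone_norm u.
  rewrite -!pD //; last exact: PZe.
  by rewrite uE -addrA addrNK addrC.
have qP u : P u -> q u = p u.
  move=> Pu; rewrite (qE u u 0) ?subr0 //; last exact: cone0.
  by rewrite -(scale0r 0) pZ ?mul0r ?subr0 //; exact: cone0.
have qlin : linear q.
  have dec u : exists v w, [/\ P v, P w & u = v - w].
    exists (`|u| *: e + u), (`|u| *: e); split.
    - by case: (cone_norm u).
    - exact: PZe.
    - by rewrite addrC addKr.
  move=> a u v.
  have [u1 [u2 [Pu1 Pu2 uE]]] := dec u; have [v1 [v2 [Pv1 Pv2 vE]]] := dec v.
  rewrite (qE _ _ _ Pu1 Pu2 uE) (qE _ _ _ Pv1 Pv2 vE) uE vE.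
  have cD := coneD Pe; have cZ := coneZ Pe.
  have [a0|a0] := leP 0 a.
    rewrite (qE _ (a *: u1 + v1) (a *: u2 + v2)); first 1 last.
    - by apply: (cD) => //; exact: cZ.
    - by apply: (cD) => //; exact: cZ.
    - by rewrite scalerBr opprD addrACA.
    rewrite !pD ?pZ //; try exact: cZ.
    by rewrite /GRing.scale/=; lra.
  (* For [a < 0] the two parts of [u] exchange roles, so that all coefficients stay nonnegative. *)
  have na0 : 0 <= - a by rewrite oppr_ge0 ltW.
  rewrite (qE _ ((- a) *: u2 + v1) ((- a) *: u1 + v2)); first 1 last.
  - by apply: (cD) => //; exact: cZ.
  - by apply: (cD) => //; exact: cZ.
  - by rewrite scalerBr opprD !scaleNr opprK [X in X + _]addrC addrACA.
  rewrite !pD ?pZ //; try exact: cZ.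
  by rewrite /GRing.scale/=; lra.
pose qL := GRing.isLinear.Build _ _ _ _ q qlin.
pose Q : {linear V -> R^o} := HB.pack q qL.
by exists Q.
Qed.

Lemma dual_bound (phi : {linear V -> R^o}) : dual phi ->
  exists2 M, 0 < M & forall u, `|phi u| <= M * `|u|.
Proof. by move=> /linear_bounded_continuous/linear_boundedP/pinfty_ex_gt0. Qed.

Lemma dual_normP (phi : {linear V -> R^o}) u : dual phi -> `|u| <= 1 ->
  `|phi u| <= dual_norm phi.
Proof.
move=> /dual_bound[M M0 phiM] u1; apply: ub_le_sup; last by exists u.
exists M => _ [v /= v1 <-]; apply: (le_trans (phiM v)).
by rewrite -[leRHS]mulr1 ler_pM2l.
Qed.

Lemma dual_norm_le (phi : {linear V -> R^o}) M :
  (forall u, `|u| <= 1 -> `|phi u| <= M) -> dual_norm phi <= M.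
Proof.
move=> phiM; apply: ge_sup.
  by exists `|phi 0|, 0 => //=; rewrite normr0 ler01.
by move=> _ [v /= v1 <-]; exact: phiM.
Qed.

(** * Continuity and norm of positive functionals *)

Section positive.
Variable psi : {linear V -> R^o}.
Hypothesis psi_ge0 : forall u, P u -> 0 <= psi u.

(** Evaluate [psi] at [c e - u] and [c e + u], which both lie in the cone. *)
Lemma positive_le u c : 0 <= c -> `|u| <= c -> `|psi u| <= c * psi e.
Proof.
move=> c0 /(cone_normP Pe _ _ c0)[/psi_ge0 + /psi_ge0].
have psiZ : psi (c *: e) = c * psi e by rewrite linearZ.
rewrite linearB linearD psiZ subr_ge0 ler_norml => h1 h2.
rewrite h1 andbT -subr_ge0 opprK addrC; exact: h2.
Qed.

Lemma positive_dual : dual psi.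
Proof.
apply/linear_bounded_continuous/bounded_funP => r.
exists (`|r| * psi e) => x xr; apply: positive_le => //.
exact: (le_trans xr (ler_norm _)).
Qed.

(** The bound of [positive_le] with [c = 1] is attained at [e], itself in the unit ball. *)
Lemma positive_dual_norm : dual_norm psi = psi e.
Proof.
have e1 : `|e| <= 1.
  apply/(cone_normP Pe); first exact: ler01.
  rewrite scale1r subrr; split; first exact: cone0.
  by apply: (coneD Pe); exact: cone_unit.
apply/eqP; rewrite eq_le; apply/andP; split.
  by apply: dual_norm_le => u u1; rewrite -[leRHS]mul1r positive_le.
apply: (le_trans (ler_norm _)); exact: (dual_normP _ _ positive_dual).
Qed.

End positive.

(** * The positive part of a continuous functional *)

Section positive_part.
Variable phi : {linear V -> R^o}.
Hypothesis phi_dual : dual phi.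

(** The Riesz-Kantorovich formula, meaningful on the cone only: elsewhere the set is empty and [sup]
    takes its default value 0. *)
Definition cone_sup (u : V) : R :=
  sup [set phi w | w in [set w | P w /\ P (u - w)]].

Lemma cone_sup_ge u w : P w -> P (u - w) -> phi w <= cone_sup u.
Proof.
move=> Pw Puw; apply: ub_le_sup; last by exists w.
have [M M0 phiM] := dual_bound _ phi_dual.
exists (M * `|u|) => _ [v /= [Pv Puv] <-].
apply: (le_trans (ler_norm _)); apply: (le_trans (phiM v)).
by rewrite ler_pM2l // cone_le_norm.
Qed.

Lemma cone_sup_le u c : P u ->
  (forall w, P w -> P (u - w) -> phi w <= c) -> cone_sup u <= c.
Proof.
move=> Pu h; apply: ge_sup; last by move=> _ [w /= [? ?] <-]; exact: h.
by exists (phi 0), 0 => //=; rewrite subr0; split => //; exact: cone0.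
Qed.

(** Subadditivity splits a competitor for [u + v] by the Riesz property; superadditivity adds
    competitors for [u] and [v]. *)
Lemma cone_supD u v : P u -> P v -> cone_sup (u + v) = cone_sup u + cone_sup v.
Proof.
move=> Pu Pv; have Puv := coneD Pe _ _ Pu Pv.
apply/eqP; rewrite eq_le; apply/andP; split.
  apply: cone_sup_le => // w Pw Puvw.
  have [w1 [w2 [-> ? ? ? ?]]] := cone_riesz Pe _ _ _ Pw Pu Pv Puvw.
  by rewrite linearD; apply: lerD; exact: cone_sup_ge.
rewrite -lerBrDr; apply: cone_sup_le => // w1 Pw1 Puw1.
rewrite lerBrDl -lerBrDr; apply: cone_sup_le => // w2 Pw2 Pvw2.
rewrite lerBrDr -linearD; apply: cone_sup_ge.
  exact: (coneD Pe).
by rewrite [w2 + _]addrC opprD addrACA; exact: (coneD Pe).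
Qed.

Lemma cone_supZ a u : 0 <= a -> P u -> cone_sup (a *: u) = a * cone_sup u.
Proof.
have P0 := cone0.
rewrite le_eqVlt => /predU1P[<- _|].
  (* By additivity [cone_sup 0] is its own double, hence zero. *)
  rewrite scale0r mul0r; apply: (@addrI _ (cone_sup 0)).
  by rewrite -cone_supD // !addr0.
have cZ := coneZ Pe.
have le_cone_supZ b v : 0 < b -> P v -> cone_sup (b *: v) <= b * cone_sup v.
  move=> b0 Pv; apply: cone_sup_le; first by apply: cZ => //; exact: ltW.
  have b'0 : 0 <= b^-1 by rewrite invr_ge0 ltW.
  move=> w Pw Pvw; rewrite -ler_pdivrMl //.
  rewrite (_ : _ * _ = phi (b^-1 *: w)); last by rewrite linearZ.
  apply: cone_sup_ge; first exact: cZ.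
  have := cZ _ _ b'0 Pvw.
  by rewrite scalerBr scalerA mulVf ?gt_eqF // scale1r.
move=> a0 Pu; apply/eqP; rewrite eq_le le_cone_supZ //=.
(* The reverse inequality is the one just proved, applied to [a^-1] and [a *: u]. *)
rewrite -ler_pdivlMl //.
have := le_cone_supZ a^-1 (a *: u).
rewrite scalerA mulVf ?gt_eqF // scale1r; apply; first by rewrite invr_gt0.
by apply: cZ => //; exact: ltW.
Qed.

End positive_part.

(** * Jordan decomposition of invariant functionals *)

(** [F] is only assumed additive, so the invariance of the order unit is stated for all its
    multiples. *)
Theorem invariant_jordan (F : V -> V) (phi : {linear V -> R^o}) :
  (forall u v, F (u + v) = F u + F v) -> (forall u, P u -> P (F u)) ->
  (forall c, F (c *: e) = c *: e) ->
  dual phi -> (forall u, phi (F u) = phi u) ->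
  exists phip phim : {linear V -> R^o},
    [/\ [/\ dual phip, (forall u, phip (F u) = phip u) &
             forall u, P u -> 0 <= phip u],
        [/\ dual phim, (forall u, phim (F u) = phim u) &
             forall u, P u -> 0 <= phim u],
        (forall u, phi u = phip u - phim u) &
        dual_norm phi = dual_norm phip + dual_norm phim].
Proof.
move=> FD FP Fe dphi phiF.
have [psi psiE] :=
  cone_linear_extension _ (cone_supD _ dphi) (cone_supZ _ dphi).
have P0 := cone0; have P1 := cone_unit.
have PZe a : 0 <= a -> P (a *: e) by move=> a0; apply: (coneZ Pe).
have psi_ge0 u : P u -> 0 <= psi u.
  move=> Pu; rewrite psiE // -(linear0 phi).
  by apply: cone_sup_ge => //; rewrite subr0.
have psi_ge u : P u -> phi u <= psi u.
  by move=> Pu; rewrite psiE //; apply: cone_sup_ge => //; rewrite subrr.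
have psiF_ge u : P u -> psi u <= psi (F u).
  move=> Pu; rewrite !psiE //; last exact: FP.
  apply: cone_sup_le => // w Pw Puw; rewrite -phiF; apply: cone_sup_ge => //.
    exact: FP.
  rewrite -{1}(subrK w u) FD addrK; exact: FP.
(* The inequalities [psiF_ge] at [u] and at its complement [|u| e - u] add up to an equality, since
   [F] fixes [|u| e]; so each of them is an equality. *)
have psiF_cone u : P u -> psi (F u) = psi u.
  move=> Pu; have [Pu' _] := cone_norm u.
  have := psiF_ge _ Pu'; have := psiF_ge _ Pu.
  have : psi (F u) + psi (F (`|u| *: e - u)) = psi u + psi (`|u| *: e - u).
    by rewrite -!linearD -FD addrC subrK Fe.
  by move=> *; lra.
have psiF u : psi (F u) = psi u.
  have [_ Pu] := cone_norm u.
  have := psiF_cone _ Pu; rewrite FD Fe !linearD; exact: addrI.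
pose chi : {linear V -> R^o} := psi \- phi.
have chi_ge0 u : P u -> 0 <= chi u by move=> Pu; rewrite /= subr_ge0 psi_ge.
exists psi, chi; split.
- by split => //; exact: positive_dual.
- by split => //; [exact: positive_dual|move=> u /=; rewrite psiF phiF].
- by move=> u /=; lra.
(* One inequality is the triangle inequality; for the other, both norms on the right are values at
   [e], with sum [2 psi e - phi e]. *)
apply/eqP; rewrite eq_le; apply/andP; split.
  apply: dual_norm_le => u u1.
  rewrite (_ : phi u = psi u - chi u); last by rewrite /=; lra.
  apply: (le_trans (ler_normB _ _)); apply: lerD.
    exact: dual_normP (positive_dual _ psi_ge0) _.
  exact: dual_normP (positive_dual _ chi_ge0) _.
rewrite (positive_dual_norm _ psi_ge0) (positive_dual_norm _ chi_ge0) /=.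
(* The bound comes from solving [phi (w + w - e) <= dual_norm phi] for [phi w]. *)
have psie : psi e <= (dual_norm phi + phi e) / 2.
  rewrite psiE //; apply: cone_sup_le => // w Pw Pew.
  have w1 : `|w + w - e| <= 1.
    apply/(cone_normP Pe); first exact: ler01.
    rewrite scale1r; split.
      rewrite opprB addrA opprD addrA addrAC -addrA.
      by apply: (coneD Pe).
    by rewrite addrC subrK; exact: (coneD Pe).
  have := le_trans (ler_norm _) (dual_normP _ _ dphi w1).
  by rewrite linearB linearD => ?; lra.
lra.
Qed.

End order_unit_space.

(** * [L^infty] as an order-unit space *)

Section Linfty.
Variable R : realType.
Local Notation mu := (@lebesgue_measure R).
Local Notation aeS := (@filterS _ _ (ae_filter_ringOfSetsType mu)).
Local Notation aeS2 := (@filterS2 _ _ (ae_filter_ringOfSetsType mu)).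
Local Notation aeS3 := (@filterS3 _ _ (ae_filter_ringOfSetsType mu)).
Local Notation fn u := (u : R -> R).

(** At exponent [+oo], [Lnorm] tests this condition before taking the essential supremum. *)
Lemma lebesgue_measureT_gt0 : (0 < mu setT)%E.
Proof.
have -> : mu [set: measurableTypeR R] = +oo%E; last exact: ltry.
by have := @lebesgue_measure_itv R `]-oo, +oo[; rewrite set_itvNyy.
Qed.

Lemma Linfty_normP (u : Linfty R) c :
  `|u| <= c <-> \forall x \ae mu, `|fn u x| <= c.
Proof.
rewrite Lspace_normE -lee_fin (finite_norm_fine (Lspace_repr u)) unlock /Lnorm.
rewrite lebesgue_measureT_gt0.
split => [/ess_supP|h]; last apply/ess_supP; [move=> h|];
  by move: h; apply: aeS => x /=; rewrite lee_fin.
Qed.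

Lemma Linfty_ex (g : R -> R) c : measurable_fun setT g ->
  (\forall x \ae mu, `|g x| <= c) ->
  exists u : Linfty R, fn u = g %[ae mu].
Proof.
move=> mg gc; have gL : g \in Lfun mu +oo.
  apply/andP; split; rewrite inE/=; first exact: mg.
  rewrite /finite_norm unlock /Lnorm lebesgue_measureT_gt0.
  apply: (@le_lt_trans _ _ c%:E); last exact: ltry.
  by apply/ess_supP; move: gc; apply: aeS => x /=; rewrite lee_fin.
exists (Lspace_pi (Lfun_Sub (leey 1%E) gL)); exact: Lspace_piE.
Qed.

Lemma Lspace_measurable p (p1 : (1 <= p)%E) (u : LspaceType mu p1) :
  measurable_fun setT (fn u).
Proof. exact: (measurable_Lfun (Lspace_repr u)). Qed.

Lemma Linfty_subE (u v : Linfty R) :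
  fn (u - v : Linfty R) = (fun x => fn u x - fn v x) %[ae mu].
Proof.
rewrite -scaleN1r.
move: (Lspace_addE u (-1 *: v)) (Lspace_scaleE (-1) v); apply: aeS2.
by move=> x /= h1 h2 _; rewrite (h1 I) (h2 I) mulN1r.
Qed.

Lemma Linfty_scale_unitE (e : Linfty R) c :
  fn e = cst 1 %[ae mu] -> fn (c *: e : Linfty R) = cst c %[ae mu].
Proof.
move: (Lspace_scaleE c e); apply: aeS2 => x /= h1 h2 _.
by rewrite (h1 I) (h2 I) mulr1.
Qed.

Lemma Linfty_order_unit_cone (e : Linfty R) : fn e = cst 1 %[ae mu] ->
  order_unit_cone R (Linfty R) (@Lspace_nonneg R +oo (leey 1)) e.
Proof.
move=> e1; split.
- move=> u v; rewrite /Lspace_nonneg; move: (Lspace_addE u v); apply: aeS3.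
  by move=> x uv u0 v0; rewrite (uv I) addr_ge0.
- move=> a u a0; rewrite /Lspace_nonneg; move: (Lspace_scaleE a u); apply: aeS2.
  by move=> x au u0; rewrite (au I) mulr_ge0.
- move=> u c c0.
  have ceE := Linfty_scale_unitE e c e1.
  split.
    move=> /Linfty_normP uc; split.
      move: uc ceE (Linfty_subE (c *: e) u); apply: aeS3.
      move=> x uc ce h.
      by rewrite (h I) (ce I) subr_ge0 (le_trans (ler_norm _)).
    move: uc ceE (Lspace_addE (c *: e) u); apply: aeS3.
    move=> x; rewrite ler_norml => /andP[uc _] ce h.
    by rewrite (h I) (ce I) /= -lerBlDl sub0r.
  move=> [h1 h2]; apply/Linfty_normP.
  have {}h1 : \forall x \ae mu, fn u x <= c.
    move: h1 ceE (Linfty_subE (c *: e) u); apply: aeS3.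
    by move=> x + ce h; rewrite (h I) (ce I) subr_ge0.
  have {}h2 : \forall x \ae mu, - c <= fn u x.
    move: h2 ceE (Lspace_addE (c *: e) u); apply: aeS3.
    by move=> x + ce h; rewrite (h I) (ce I) /= -lerBlDl sub0r.
  by move: h1 h2; apply: aeS2 => x ? ?; rewrite ler_norml; apply/andP.
move=> w u v w0 u0 v0 uvw0.
(* The Riesz decomposition is [w1 = min(w, u)] and [w - w1 = max(0, w - u)]; the latter is at most
   [v] because both [0] and [w - u] are. *)
have [w1 w1E] : exists w1 : Linfty R,
    fn w1 = (fun x => Num.min (fn w x) (fn u x)) %[ae mu].
  apply: (@Linfty_ex _ `|u|).
    apply: measurable_minr; exact: Lspace_measurable.
  move: w0 u0 ((Linfty_normP u _).1 (lexx _)); apply: aeS3 => x w0 u0 ux.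
  by rewrite ger0_norm ?le_min ?w0 // ge_min (le_trans (ler_norm _) ux) orbT.
have w2E := Linfty_subE w w1.
exists w1, (w - w1); split.
- by rewrite addrC subrK.
- by move: w0 u0 w1E; apply: aeS3 => x w0 u0 ->//; rewrite le_min w0.
- move: w1E (Linfty_subE u w1); apply: aeS2 => x h1 h2.
  by rewrite (h2 I) (h1 I) subr_ge0 ge_min lexx orbT.
- move: w1E w2E; apply: aeS2 => x h1 h2.
  by rewrite (h2 I) (h1 I) subr_ge0 ge_min lexx.
- have {}uvw0 : \forall x \ae mu, 0 <= fn u x + fn v x - fn w x.
    move: uvw0 (Linfty_subE (u + v) w) (Lspace_addE u v); apply: aeS3.
    by move=> x + h1 h2; rewrite (h1 I) (h2 I).
  have {}w2E : \forall x \ae mu,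
      fn (w - w1 : Linfty R) x = fn w x - Num.min (fn w x) (fn u x).
    by move: w1E w2E; apply: aeS2 => x h1 h2; rewrite (h2 I) (h1 I).
  have {}w2E : \forall x \ae mu, fn (w - w1 : Linfty R) x <= fn v x.
    move: w2E uvw0 v0; apply: aeS3 => x -> uvw v0.
    by case: (leP (fn w x)) => _; lra.
  move: w2E (Linfty_subE v (w - w1)); apply: aeS2 => x h1 h2.
  by rewrite (h2 I) subr_ge0.
Qed.

(** * Convolution by an element of [L1flat] *)

Lemma conv_integrable (g h : R -> R) x :
  g \in Lfun mu 1 -> h \in Lfun mu +oo ->
  mu.-integrable setT (EFin \o (fun t => h (x - t) * g t)).
Proof.
move=> /[dup] /sub_Lfun_mfun; rewrite inE/= => mg /Lfun1_integrable gi hL.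
have mh : measurable_fun setT h by case/andP: hL; rewrite inE.
(* Passing to the class of [h] provides its essential bound as a norm. *)
pose u : Linfty R := Lspace_pi (Lfun_Sub (leey 1%E) hL).
have hC : \forall t \ae mu, `|h t| <= `|u|.
  have uE : fn u = h %[ae mu] := Lspace_piE (Lfun_Sub (leey 1%E) hL).
  move: uE ((Linfty_normP u _).1 (lexx _)); apply: aeS2.
  by move=> t <-.
have mhg := measurable_conv_integrand x mg mh.
have /integrableP[mCg Cgfin] : mu.-integrable setT (fun t => (`|u| * g t)%:E).
  by apply: eq_integrable (integrableZl measurableT `|u| gi).
apply/integrableP; split; first exact/measurable_EFinP.
apply: le_lt_trans Cgfin; apply: ae_ge0_le_integral => //.
- by apply: measurableT_comp => //; exact/measurable_EFinP.
- exact: measurableT_comp.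
(* The map [t |-> x - t] preserves null sets, so the essential bound on [h] dominates the integrand
   by a multiple of [g]. *)
move: (ae_reflect x hC); apply: aeS => t hx _.
by rewrite lee_fin /= !normrM normr_id ler_wpM2r.
Qed.

Variable f : L1 R.
Hypothesis f_flat : L1flat f.

(** This is the real part of the Fourier transform at 0, where the exponential is 1. *)
Lemma L1flat_Rintegral : \int[mu]_t fn f t = 1.
Proof.
have [_ ] := f_flat; rewrite /fourier /complex_integral => -[int1 _].
apply: etrans int1; apply: eq_Rintegral => x _ /=.
by rewrite mul0r oppr0 cos0 mulr1 mul0r subr0.
Qed.

Lemma conv_opD u v : conv_op f (u + v) = conv_op f u + conv_op f v.
Proof.
apply: LspaceP.
(* The representative of [u + v] is the pointwise sum only almost everywhere, yet the convolutions
   agree at every point. *)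
have uvE : Defs.conv (fn f) (fn (u + v : Linfty R)) =
    Defs.conv (fn f) (fun x => fn u x + fn v x).
  apply: conv_ae_eq; try exact: Lspace_measurable.
  - exact: measurable_funD (Lspace_measurable _ _ u) (Lspace_measurable _ _ v).
  - exact: ae_eq_refl.
  - exact: Lspace_addE.
have cD x : Defs.conv (fn f) (fn (u + v : Linfty R)) x =
    Defs.conv (fn f) (fn u) x + Defs.conv (fn f) (fn v) x.
  rewrite uvE /Defs.conv -RintegralD //;
    try by apply: conv_integrable; exact: Lspace_Lfun.
  by apply: eq_Rintegral => t _; rewrite mulrDl.
have := conv_opE f (u + v); have := conv_opE f u; have := conv_opE f v.
move=> hv hu huv; have h := Lspace_addE (conv_op f u) (conv_op f v).
have {}h : \forall x \ae mu, fn (conv_op f u + conv_op f v : Linfty R) x =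
    Defs.conv (fn f) (fn u) x + Defs.conv (fn f) (fn v) x.
  by move: h hu hv; apply: aeS3 => x h hu hv; rewrite (h I) (hu I) (hv I).
by move: h huv; apply: aeS2 => x h huv _; rewrite h (huv I) cD.
Qed.

Lemma conv_op_ge0 u : Lspace_nonneg u -> Lspace_nonneg (conv_op f u).
Proof.
have [f0 _] := f_flat; move=> u0.
move: (conv_opE f u); apply: aeS => x /(_ I) ->.
(* [f] and [u] may be negative on null sets. *)
rewrite (@conv_ae_eq _ f (Num.norm \o fn f) (fn u) (Num.norm \o fn u)).
- by apply: Rintegral_ge0 => t _; apply: mulr_ge0; exact: normr_ge0.
- exact: Lspace_measurable.
- exact: measurableT_comp (@normr_measurable R setT) (Lspace_measurable _ _ _).
- exact: Lspace_measurable.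
- exact: measurableT_comp (@normr_measurable R setT) (Lspace_measurable _ _ _).
- by move: f0; apply: aeS => t ft _; rewrite /= ger0_norm.
- by move: u0; apply: aeS => t ut _; rewrite /= ger0_norm.
Qed.

(** Convolving the constant [c] with [f] yields [c] times the integral of [f], which is 1. *)
Lemma conv_op_cst (e : Linfty R) c :
  fn e = cst 1 %[ae mu] -> conv_op f (c *: e) = c *: e.
Proof.
move=> e1; apply: LspaceP.
have ceE := Linfty_scale_unitE e c e1.
have cE : Defs.conv (fn f) (fn (c *: e : Linfty R)) = cst c.
  transitivity (Defs.conv (fn f) (cst c)).
    apply: conv_ae_eq ceE; try exact: Lspace_measurable.
      exact: measurable_cst.
    exact: ae_eq_refl.
  apply/funext => x.
  have fi : mu.-integrable setT (EFin \o fn f).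
    by have /Lfun1_integrable := Lspace_Lfun f.
  apply: etrans (RintegralZl c measurableT fi) _.
  by rewrite L1flat_Rintegral mulr1.
move: (conv_opE f (c *: e)) ceE; apply: aeS2 => x h1 h2 _.
by apply: (etrans (h1 I)); rewrite cE; exact/esym/h2.
Qed.
End Linfty.

Theorem theorem3p8 (R : realType) (f : L1 R) (f_flat : L1flat f)
    (phi : {linear Linfty R -> R^o})
    (phi_inv : invariant_dual (conv_op f) phi) :
  exists phip phim : {linear Linfty R -> R^o},
    [/\ invariant_dual (conv_op f) phip /\ positive_functional phip,
        invariant_dual (conv_op f) phim /\ positive_functional phim,
        (forall u : Linfty R, phi u = phip u - phim u) &
        dual_norm phi = dual_norm phip + dual_norm phim].
Proof.
(* The order unit is the class of the constant function 1. *)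
have [e e1] : exists e : Linfty R,
    (e : R -> R) = cst 1 %[ae @lebesgue_measure R].
  by apply: (@Linfty_ex _ _ 1) => //; apply: aeW => x /=; rewrite normr1.
have [dphi phiF] := phi_inv.
have [phip [phim [[? ? ?] [? ? ?] ? ?]]] := invariant_jordan _ _ _ _
  (Linfty_order_unit_cone _ _ e1) _ _ (conv_opD _ f) (conv_op_ge0 _ _ f_flat)
  (fun c => conv_op_cst _ _ f_flat _ c e1) dphi phiF.
by exists phip, phim.
Qed.
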